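(* Let $N,k,K_0$ be positive integers and let $A_i=(T_i,E_i)$, $1\le i\le N$, be finite simple directed graphs, each of which is $k$-colourable. Suppose $B\subset T_1\times T_2\times\cdots\times T_N$ satisfies: (1) each $\vec x=(x_1,\dots,x_N)\in B$ is associated with $K_0$ indices $1\le I_1(\vec x)<I_2(\vec x)<\cdots<I_{K_0}(\vec x)\le N$ and $K_0$ edges $e_j(\vec x)\in E_{I_j(\vec x)}$ $(j=1,\dots,K_0)$ such that $e_j(\vec x)^-=x_{I_j(\vec x)}$ for $j=1,\dots,K_0$; (2) $|B|>K_0^{-1}k^2N^{1/2}|T_1||T_2|\cdots|T_N|$. Then there exist $\vec x,\vec y\in B$ such that: (a) for each $i=1,\dots,N$, either $x_i=y_i$ or $(x_i,y_i)\in E_i$; (b) there exists $j\in\{1,\dots,K_0\}$ such that $(x_{I_j(\vec x)},y_{I_j(\vec x)})=e_j(\vec x)$.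
   Context: A simple directed graph $A=(T,E)$ has vertex set $T$ and set $E$ of directed edges, without multi-edges or self-loops. For $e\in E$, $e^-$ and $e^+$ denote its starting and ending vertices, so $e=(e^-,e^+)$. Two edges $e_1,e_2$ have no intersection if $e_1^\pm,e_2^\pm$ are four different vertices. $A$ is $k$-colourable if $E$ can be written as a disjoint union $E=\bigcup_{j=1}^kE_j$ such that for each $j$, any two distinct edges in $E_j$ have no intersection. *)

(* Defs.v *)
From HB Require Import structures.
From mathcomp Require Import all_boot all_order all_algebra.
Set Implicit Arguments.
Unset Strict Implicit.
Unset Printing Implicit Defensive.

(* Edges are ordered pairs, so (a, b) and (b, a) may both be edges. *)
Record sdigraph := SDigraph {
  vertex : finType;
  edges : {set vertex * vertex};
  edges_no_loop : forall e, e \in edges -> e.1 != e.2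
}.

Definition no_intersection (T : finType) (e1 e2 : T * T) : bool :=
  uniq [:: e1.1; e1.2; e2.1; e2.2].

Definition colourable (k : nat) (A : sdigraph) : Prop :=
  exists F : 'I_k -> {set vertex A * vertex A},
    [/\ edges A = \bigcup_(j < k) F j,
        forall j1 j2, j1 != j2 -> [disjoint F j1 & F j2]
      & forall j, {in F j &, forall e1 e2, e1 != e2 -> no_intersection e1 e2}].

(* Main.v *)
Require Import Defs.
From HB Require Import structures.
From mathcomp Require Import all_boot all_order all_algebra.
From mathcomp Require Import lra.
Set Implicit Arguments.
Unset Strict Implicit.
Unset Printing Implicit Defensive.
Import Order.TTheory GRing.Theory Num.Theory.
Local Open Scope ring_scope.

(** The idea is to compare [B] with the boundary of a monotone subset of a
    product of matchings, and to bound that boundary as one bounds the total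
    influence of a monotone Boolean function.

    Keep only the edges of one colour in every coordinate, so that each graph
    becomes a matching: its edges go from tails to heads, and no vertex is both.
    Moving some coordinates from a tail to its head is then a partial order
    ([le_matching]) on the product.  Let [P] consist of the pairs (x, i) for
    which [x] is in [B] and one of the edges prescribed at [x] has this colour
    and lies in coordinate [i].  If no [x] and [y] as required exist, consider
    the up-set [U] generated by the points obtained from the pairs (x, i) of [P]
    by moving [x] along its edge in coordinate [i].  It contains no [x]
    occurring in a pair of [P], so distinct pairs of [P] give distinct edges of
    the product that enter [U].

    Let [orientation] be 1 at heads, -1 at tails and 0 elsewhere.  Reversing the
    edge at coordinate [i] shows that the sum over [U] of the orientation of
    coordinate [i] is the number of edges in direction [i] that enter [U]
    ([card_boundary_le]).  Hence #|P| is at most the sum over [U] of [imbalance],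
    the total orientation of a point.  The orientations of different
    coordinates are orthogonal, so the mean square of the imbalance is at most
    the number N of coordinates ([sum_imbalance_sqr]), and its mean absolute
    value is at most the square root of N.  This gives
    #|P| <= sqrt N * #|T_1| ... #|T_N| ([card_antichain_le]).

    Summing over the [k] colours counts every pair of a point of [B] and one of
    its [K0] edges, whence K0 * #|B| <= k * sqrt N * #|T_1| ... #|T_N|, which
    contradicts the assumption on the size of [B]. *)

(** * Matchings *)

Definition is_matching (T : finType) (F : {set T * T}) : Prop :=
  {in F, forall e, e.1 != e.2} /\
  {in F &, forall e1 e2, e1 != e2 -> no_intersection e1 e2}.

Section Matching.
Variables (T : finType) (F : {set T * T}).
Hypothesis F_matching : is_matching F.

Definition is_tail (v : T) : bool := [exists w, (v, w) \in F].
Definition is_head (v : T) : bool := [exists w, (w, v) \in F].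
Definition adjacent (v w : T) : bool := ((v, w) \in F) || ((w, v) \in F).

(** Fixing the vertices outside the matching makes this a total involution,
    so that it can be used to reindex sums over all vertices. *)
Definition partner (v : T) : T := odflt v [pick w | adjacent v w].

Lemma head_not_tail v : is_head v -> is_tail v -> False.
Proof.
case: F_matching => noloop disj /existsP[u uv] /existsP[w vw].
have [E|/(disj _ _ uv vw)] := eqVneq (u, v) (v, w).
  by case: E => uE _; move: (noloop _ uv); rewrite /= uE eqxx.
by rewrite /no_intersection /= !inE eqxx /= andbF.
Qed.

Lemma out_edge_unique v w w' : (v, w) \in F -> (v, w') \in F -> w = w'.
Proof.
case: F_matching => noloop disj vw vw'.
have [[//]|/(disj _ _ vw vw')] := eqVneq (v, w) (v, w').
by rewrite /no_intersection /= !inE eqxx /= orbT.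
Qed.

Lemma in_edge_unique v w w' : (w, v) \in F -> (w', v) \in F -> w = w'.
Proof.
case: F_matching => noloop disj wv wv'.
have [[//]|/(disj _ _ wv wv')] := eqVneq (w, v) (w', v).
by rewrite /no_intersection /= !inE eqxx /= orbT andbF.
Qed.

Lemma adjacent_unique v w w' : adjacent v w -> adjacent v w' -> w = w'.
Proof.
move=> /orP[vw|vw] /orP[vw'|vw'].
- exact: out_edge_unique vw vw'.
- by case: (@head_not_tail v); apply/existsP; [exists w'|exists w].
- by case: (@head_not_tail v); apply/existsP; [exists w|exists w'].
- exact: in_edge_unique vw vw'.
Qed.

Lemma partner_adjacent v w : adjacent v w -> partner v = w.
Proof.
rewrite /partner; case: pickP => [u vu vw|/(_ w)->//].
exact: adjacent_unique vu vw.
Qed.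

Lemma partnerK : involutive partner.
Proof.
move=> v; rewrite {2}/partner; case: pickP => [w vw|none] /=.
  by apply: partner_adjacent; rewrite /adjacent orbC.
by rewrite /partner; case: pickP => // w; rewrite none.
Qed.

Lemma tail_partner v : is_tail v -> (v, partner v) \in F.
Proof.
by case/existsP=> w vw; rewrite (@partner_adjacent v w) // /adjacent vw.
Qed.

Lemma head_partner v : is_head v -> (partner v, v) \in F.
Proof.
by case/existsP=> w wv; rewrite (@partner_adjacent v w) // /adjacent wv orbT.
Qed.

Lemma is_head_partner v : is_head (partner v) = is_tail v.
Proof.
apply/idP/idP => [/head_partner|/tail_partner vw]; last first.
  by apply/existsP; exists v.
by rewrite partnerK => vw; apply/existsP; exists (partner v).
Qed.

Lemma is_tail_partner v : is_tail (partner v) = is_head v.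
Proof. by rewrite -is_head_partner partnerK. Qed.

End Matching.

(** * Products of matchings *)

Section Product.
Variables (R : rcfType) (J : finType) (V : J -> finType).
Variable F : forall i : J, {set V i * V i}.
Hypothesis F_matching : forall i, is_matching (F i).

Local Notation point := {dffun forall i : J, V i}.

Definition flip (i : J) (x : point) : point :=
  [ffun l : J => if l == i then partner (F l) (x l) else x l].

Definition le_matching (x y : point) : bool :=
  [forall i, (x i == y i) || ((x i, y i) \in F i)].

Definition orientation (i : J) (x : point) : R :=
  (is_head (F i) (x i))%:R - (is_tail (F i) (x i))%:R.

Definition imbalance (x : point) : R := \sum_i orientation i x.

Lemma flipK i : involutive (flip i).
Proof.
move=> x; apply/ffunP => l; rewrite !ffunE.
by case: eqP => // _; rewrite partnerK.
Qed.

Lemma flip_id i (x : point) : flip i x i = partner (F i) (x i).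
Proof. by rewrite ffunE eqxx. Qed.

Lemma flip_neq i l (x : point) : l != i -> flip i x l = x l.
Proof. by rewrite ffunE => /negPf->. Qed.

Lemma le_matching_flip i (x : point) :
  is_tail (F i) (x i) -> le_matching x (flip i x).
Proof.
move=> tail_xi; apply/forallP => l.
have [->|li] := eqVneq l i; last by rewrite flip_neq // eqxx.
by rewrite flip_id tail_partner ?orbT.
Qed.

Lemma orientation_flip i x : orientation i (flip i x) = - orientation i x.
Proof.
by rewrite /orientation flip_id is_head_partner // is_tail_partner // opprB.
Qed.

Lemma orientation_flip_neq i l x :
  l != i -> orientation l (flip i x) = orientation l x.
Proof. by move=> li; rewrite /orientation flip_neq. Qed.

Lemma orientation_sqr_le1 i x : orientation i x ^+ 2 <= 1.
Proof.
rewrite /orientation; case: (is_head _ _); case: (is_tail _ _);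
  by rewrite ?subrr ?subr0 ?sub0r ?sqrrN ?expr1n ?expr0n.
Qed.

(** Flipping coordinate [i] changes the sign of the summand. *)
Lemma orientation_orthogonal i l :
  l != i -> \sum_(x : point) orientation i x * orientation l x = 0.
Proof.
move=> li; set S := (LHS).
have flipS : S = - S.
  rewrite {1}/S (reindex_inj (inv_inj (flipK i))) /= /S -sumrN.
  apply: eq_bigr => x _.
  by rewrite orientation_flip orientation_flip_neq // mulNr.
by lra.
Qed.

Lemma sum_imbalance_sqr :
  \sum_(x : point) imbalance x ^+ 2 <= #|J|%:R * #|{: point}|%:R.
Proof.
have -> : \sum_(x : point) imbalance x ^+ 2
          = \sum_i \sum_l \sum_(x : point) orientation i x * orientation l x.
  under eq_bigr do rewrite expr2 /imbalance mulr_suml.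
  rewrite exchange_big /=; apply: eq_bigr => i _.
  under eq_bigr do rewrite mulr_sumr.
  by rewrite exchange_big.
rewrite -sum1_card natr_sum mulr_suml; apply: ler_sum => i _.
rewrite mul1r (bigD1 i) //= [X in _ + X]big1 ?addr0; last first.
  by move=> l; apply: orientation_orthogonal.
rewrite -sum1_card natr_sum; apply: ler_sum => x _.
by rewrite -expr2 orientation_sqr_le1.
Qed.

(** Summing the inequality of arithmetic and geometric means
    [D <= (D ^+ 2 / r + r) / 2] with [r] the square root of [#|J|].  Its right
    side is nonnegative, so its sum over [U] is at most its sum over all points,
    which the mean square of [D] controls. *)
Lemma sum_imbalance_le (U : {set point}) :
  (0 < #|J|)%N ->
  \sum_(x in U) imbalance x <= Num.sqrt #|J|%:R * #|{: point}|%:R.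
Proof.
move=> J_gt0; set r := Num.sqrt _.
have r_gt0 : 0 < r by rewrite sqrtr_gt0 ltr0n.
have rr : r ^+ 2 = #|J|%:R by rewrite sqr_sqrtr // ler0n.
pose g x := (imbalance x ^+ 2 + r ^+ 2) / (2 * r).
have g_ge0 x : 0 <= g x.
  by rewrite divr_ge0 ?addr_ge0 ?sqr_ge0 // mulr_ge0 // ltW.
apply: (@le_trans _ _ (\sum_(x : point) g x)).
  apply: (@le_trans _ _ (\sum_(x in U) g x)).
    apply: ler_sum => x _; rewrite ler_pdivlMr ?mulr_gt0 //.
    by have := sqr_ge0 (imbalance x - r); nra.
  by rewrite [leRHS](bigID (mem U)) /= lerDl sumr_ge0.
rewrite -mulr_suml ler_pdivrMr ?mulr_gt0 // big_split /= sumr_const.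
have -> : r ^+ 2 *+ #|{: point}| = #|J|%:R * #|{: point}|%:R.
  by rewrite rr mulr_natr.
have := sum_imbalance_sqr; rewrite -rr; nra.
Qed.

(** In coordinate [i], the map [flip i] sends the points of [U] at a tail and
    the points of [X] to distinct points of [U] at a head. *)
Lemma card_boundary_le (U X : {set point}) (i : J) :
  {in U, forall y : point, is_tail (F i) (y i) -> flip i y \in U} ->
  {in X, forall x : point,
     [/\ is_tail (F i) (x i), x \notin U & flip i x \in U]} ->
  #|X|%:R <= \sum_(y in U) orientation i y.
Proof.
move=> U_up X_enters.
pose H := [set y : point in U | is_head (F i) (y i)].
pose L := [set y : point in U | is_tail (F i) (y i)].
have -> : \sum_(y in U) orientation i y = #|H|%:R - #|L|%:R.
  have card_filter (b : pred point) :
      #|[set y in U | b y]|%:R = \sum_(y in U) (b y)%:R :> R.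
    rewrite -sum1_card -natr_sum; congr _%:R.
    under eq_bigl do rewrite inE.
    by rewrite big_mkcondr; apply: eq_bigr => y _; case: (b y).
  by rewrite sumrB !card_filter.
rewrite lerBrDr -natrD ler_nat addnC -cardsUI.
have -> : L :&: X = set0.
  apply/setP => y; rewrite !inE; apply/negP => /andP[/andP[yU _]].
  by case/X_enters; rewrite yU.
rewrite cards0 addn0 -(card_imset _ (inv_inj (flipK i))) subset_leq_card //.
apply/subsetP => _ /imsetP[y yLX ->]; rewrite inE flip_id is_head_partner //.
case/setUP: yLX => [|/X_enters[-> _ ->]//].
by rewrite inE => /andP[yU ty]; rewrite U_up.
Qed.

(** Each pair (x, i) of [P] is an edge entering the up-set [U] generated by the
    points [flip i x]: the antichain condition keeps [x] out of [U].  The set [U]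
    is stable under flipping a tail because in a matching a coordinate moves at
    most once: a coordinate that was already moved is a head. *)
Lemma card_antichain_le (P : {set point * J}) :
  (0 < #|J|)%N ->
  (forall (x : point) i, (x, i) \in P -> is_tail (F i) (x i)) ->
  (forall (x : point) i (y : point) j,
     (x, i) \in P -> (y, j) \in P -> le_matching x y ->
     (x i, y i) \notin F i) ->
  #|P|%:R <= Num.sqrt #|J|%:R * #|{: point}|%:R :> R.
Proof.
move=> J_gt0 P_tail P_anti.
pose U := [set y : point | [exists p in P,
  le_matching p.1 y && ((p.1 p.2, y p.2) \in F p.2)]].
have memU (y x : point) i :
    (x, i) \in P -> le_matching x y -> (x i, y i) \in F i -> y \in U.
  by move=> xP xy xyi; rewrite inE; apply/existsP; exists (x, i); rewrite xP xy.
have U_up i : {in U, forall y : point, is_tail (F i) (y i) -> flip i y \in U}.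
  move=> y; rewrite inE => /existsP[[x j] /= /and3P[xP /forallP xy xyj]] ty.
  (* An edge ending at the tail y i would make it a head as well, so that
     coordinate i agrees with x and the flip moves it for the first time. *)
  have noedge w : (w, y i) \notin F i.
    by apply/negP => wy; apply: (head_not_tail (F_matching i) _ ty);
      apply/existsP; exists w.
  have ji : j != i.
    by apply/eqP => ji; move: (noedge (x i)); rewrite -ji xyj.
  apply: (memU _ x j) => //; last by rewrite flip_neq.
  apply/forallP => l; have [->|li] := eqVneq l i; last by rewrite flip_neq.
  have := xy i; rewrite (negPf (noedge _)) orbF => /eqP->.
  by rewrite flip_id tail_partner ?orbT.
apply: le_trans (sum_imbalance_le U J_gt0).
rewrite exchange_big /=.
pose X i := [set x : point | (x, i) \in P].
have -> : #|P| = (\sum_i #|X i|)%N.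
  have cardX i : #|X i| = (\sum_(x : point | (x, i) \in P) 1)%N.
    by rewrite -sum1_card; apply: eq_bigl => x; rewrite inE.
  rewrite (eq_bigr _ (fun i _ => cardX i)) (exchange_big_dep predT) //=.
  by rewrite -sum1_card pair_big_dep /=; apply: eq_bigl => -[x i].
rewrite natr_sum; apply: ler_sum => i _; apply: card_boundary_le (U_up i) _.
move=> x; rewrite inE => xP; have tx := P_tail _ _ xP; split=> //.
  rewrite inE; apply/negP => /existsP[[z j] /= /and3P[zP zx]].
  exact/negP/(P_anti z j x i).
by apply: (memU _ x i) => //; rewrite ?le_matching_flip // flip_id tail_partner.
Qed.

End Product.

(** * Summing over the colours *)

Theorem lemma3p16 (R : rcfType) (N k K0 : nat)
  (N_gt0 : (0 < N)%N) (k_gt0 : (0 < k)%N) (K0_gt0 : (0 < K0)%N)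
  (A : 'I_N -> sdigraph)
  (A_col : forall i, colourable k (A i))
  (B : {set {dffun forall i : 'I_N, vertex (A i)}})
  (I : {dffun forall i : 'I_N, vertex (A i)} -> 'I_K0 -> 'I_N)
  (e : forall (x : {dffun forall i : 'I_N, vertex (A i)}) (j : 'I_K0),
      vertex (A (I x j)) * vertex (A (I x j)))
  (I_incr : forall x, x \in B ->
      forall j1 j2 : 'I_K0, (j1 < j2)%N -> (I x j1 < I x j2)%N)
  (e_edge : forall x, x \in B -> forall j, e x j \in edges (A (I x j)))
  (e_start : forall x, x \in B -> forall j, (e x j).1 = x (I x j))
  (B_large : K0%:R^-1 * k%:R ^+ 2 * Num.sqrt N%:R
               * \prod_(i < N) #|vertex (A i)|%:R < #|B|%:R :> R) :
  exists x y : {dffun forall i : 'I_N, vertex (A i)},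
    [/\ x \in B, y \in B,
        forall i, x i = y i \/ (x i, y i) \in edges (A i)
      & exists j : 'I_K0, (x (I x j), y (I x j)) = e x j].
Proof.
have [F F_col] := fin_all_exists A_col.
have F_edges i a f : f \in F i a -> f \in edges (A i).
  by case: (F_col i) => -> _ _ fF; apply/bigcupP; exists a.
have F_matching a i : is_matching (F i a).
  split=> [f /F_edges/edges_no_loop//|]; by case: (F_col i) => _ _; apply.
pose linked x y := [&& x \in B, y \in B,
  [forall i, (x i == y i) || ((x i, y i) \in edges (A i))]
  & [exists j, (x (I x j), y (I x j)) == e x j]].
have [/existsP[x /existsP[y /and4P[xB yB /forallP xy /existsP[j /eqP xyj]]]]|] :=
  boolP [exists x, exists y, linked x y].
  exists x, y; split=> // [i|]; last by exists j.
  by case/orP: (xy i) => [/eqP|]; [left|right].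
move/existsPn => unlinked; exfalso.
have I_inj x : x \in B -> injective (I x).
  move=> xB j1 j2 E; apply: ord_inj.
  by case: (ltngtP j1 j2) => // /(I_incr _ xB); rewrite E ltnn.
pose Q a := [set xj | (xj.1 \in B) && (e xj.1 xj.2 \in F (I xj.1 xj.2) a)].
have Q_le a :
    #|Q a|%:R <= Num.sqrt N%:R * (\prod_(i < N) #|vertex (A i)|)%:R :> R.
  (* The indices I x j are distinct for x in B, so recording the coordinate
     instead of j loses no pair. *)
  pose base (xj : {dffun forall i : 'I_N, vertex (A i)} * 'I_K0) :=
    (xj.1, I xj.1 xj.2).
  have <- : #|base @: Q a| = #|Q a|.
    apply: card_in_imset => -[x j] [y l]; rewrite !inE /= => /andP[xB _] _.
    by rewrite /base /= => -[<-] /(I_inj _ xB) <-.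
  have Qe x j : x \in B -> e x j \in F (I x j) a ->
      (x (I x j), (e x j).2) \in F (I x j) a.
    by move=> xB; rewrite -(e_start _ xB j) -surjective_pairing.
  have -> : (\prod_(i < N) #|vertex (A i)|)%N
            = #|{: {dffun forall i : 'I_N, vertex (A i)}}|.
    by rewrite card_dep_ffun foldrE big_map big_enum.
  rewrite -[N in Num.sqrt N%:R]card_ord.
  apply: (@card_antichain_le R _ _ (fun i => F i a)); rewrite ?card_ord //.
    move=> x i /imsetP[[x' j]]; rewrite inE /= => /andP[xB xF] [-> ->].
    by apply/existsP; exists (e x' j).2; apply: Qe.
  move=> x i y l /imsetP[[x' j]]; rewrite inE /= => /andP[xB xF] [-> ->].
  move=> /imsetP[[y' j']]; rewrite inE /= => /andP[yB _] [-> _] /forallP xy.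
  apply/negP => xyj; move/existsPn: (unlinked x') => /(_ y')/negP; apply.
  apply/and4P; split=> //.
    by apply/forallP => m; case/orP: (xy m) => [->//|/F_edges ->]; rewrite orbT.
  apply/existsP; exists j; apply/eqP.
  rewrite [e x' j]surjective_pairing e_start //; congr (_, _).
  exact: (out_edge_unique (F_matching a _) xyj (Qe _ _ xB xF)).
have BQ : (#|B| * K0 <= \sum_(a < k) #|Q a|)%N.
  rewrite -{1}[K0]card_ord -cardsT -cardsX.
  apply: (@leq_trans #|\bigcup_(a < k) Q a|).
    apply/subset_leq_card/subsetP => -[x j]; rewrite !inE andbT /= => xB.
    have := e_edge _ xB j; case: (F_col (I x j)) => -> _ _ /bigcupP[a _ xF].
    by apply/bigcupP; exists a => //; rewrite inE xB.
  elim/big_rec2: _ => [|a m S _ le]; first by rewrite cards0.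
  by rewrite (leq_trans (leq_card_setU _ _)) // leq_add2l.
move: B_large; apply/negP; rewrite -leNgt.
rewrite -natr_prod.
set M := (X in _ * X%:R) in Q_le *.
set r := Num.sqrt N%:R in Q_le *.
have KB : #|B|%:R * K0%:R <= k%:R * (r * M%:R).
  rewrite -natrM; apply: (@le_trans _ _ (\sum_(a < k) #|Q a|%:R)).
    by rewrite -natr_sum ler_nat.
  apply: (@le_trans _ _ (\sum_(a < k) r * M%:R)); first exact: ler_sum.
  by rewrite sumr_const card_ord mulr_natl.
rewrite -!mulrA ler_pdivlMl ?ltr0n // mulrC (le_trans KB) //.
apply: ler_wpM2l; first exact: ler0n.
by apply: ler_peMl; rewrite ?ler1n // mulr_ge0 ?sqrtr_ge0 ?ler0n.
Qed.
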